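(* Every geometrically griddable permutation class is partially well ordered under the containment order on permutations.
   Context: A permutation of length $n\ge 0$ is a bijection of $\{1,\dots,n\}$, written in one-line notation. A permutation $\pi$ of length $n$ contains a permutation $\sigma$ of length $k$ (written $\sigma\le\pi$) if $\pi$ has a subsequence of length $k$ that is order isomorphic to $\sigma$. A permutation class is a set of permutations that is downward closed under $\le$. A partially ordered set is partially well ordered (pwo) if it contains neither an infinite strictly descending chain nor an infinite antichain; a permutation class is regarded as a poset under $\le$. Matrices are indexed first by column (left to right) and then by row (bottom to top); a $t\times u$ matrix has $t$ columns and $u$ rows. Let $M$ be a $t\times u$ matrix with entries in $\{0,1,-1\}$. The standard figure $\Lambda$ of $M$ is the subset of $\mathbb{R}^2$ consisting of the increasing open line segment from $(k-1,\ell-1)$ to $(k,\ell)$ for each $(k,\ell)$ with $M_{k,\ell}=1$, and the decreasing open line segment from $(k-1,\ell)$ to $(k,\ell-1)$ for each $(k,\ell)$ with $M_{k,\ell}=-1$. The geometric grid class $\operatorname{Geom}(M)$ is the set of all permutations obtained as follows: choose finitely many points of $\Lambda$, no two on a common horizontal or vertical line, label them $1,\dots,n$ from bottom to top, and read the labels from left to right. A permutation class is geometrically griddable if it is contained in $\operatorname{Geom}(M)$ for some matrix $M$ with entries in $\{0,1,-1\}$. *)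

(* Defs.v *)
From mathcomp Require Import all_boot all_order all_algebra all_fingroup.
From mathcomp Require Import classical_sets cardinality reals.

Set Implicit Arguments.
Unset Strict Implicit.
Unset Printing Implicit Defensive.

Import Order.TTheory GRing.Theory Num.Theory.

Local Open Scope classical_set_scope.
Local Open Scope ring_scope.

(* Positions and values are 0-based: 'S_n is the type of bijections of
   {0, ..., n-1}, and [p i] is the entry at position [i] of the one-line
   notation. *)
Definition permutation : Type := {n : nat & 'S_n}.

Definition plength (p : permutation) : nat := projT1 p.

Definition pval (p : permutation) : 'S_(plength p) := projT2 p.

(* [contained s p] is s <= p; [f] lists the positions of a subsequence of [p]
   order isomorphic to [s]. *)
Definition contained (s p : permutation) : Prop :=
  exists f : 'I_(plength s) -> 'I_(plength p),
    (forall i j : 'I_(plength s), (i < j)%N -> (f i < f j)%N) /\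
    (forall i j : 'I_(plength s),
       (pval s i < pval s j)%N = (pval p (f i) < pval p (f j))%N).

Definition permutation_class (C : set permutation) : Prop :=
  forall s p, C p -> contained s p -> C s.

Definition infinite_descending_chain (T : Type) (le : T -> T -> Prop)
    (C : set T) (a : nat -> T) : Prop :=
  forall n, C (a n) /\ (le (a n.+1) (a n) /\ a n.+1 <> a n).

Definition infinite_antichain (T : Type) (le : T -> T -> Prop)
    (C A : set T) : Prop :=
  [/\ A `<=` C, infinite_set A
    & forall x y, A x -> A y -> x <> y -> ~ le x y].

(* The subset [C] of [T], ordered by (the restriction of) [le], is pwo. *)
Definition partially_well_ordered (T : Type) (le : T -> T -> Prop)
    (C : set T) : Prop :=
  ~ (exists a, infinite_descending_chain le C a) /\
  ~ (exists A, infinite_antichain le C A).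

Definition open_segment (R : realType) (a b : R * R) : set (R * R) :=
  [set z | exists2 s : R, 0 < s < 1 &
     z = ((1 - s) * a.1 + s * b.1, (1 - s) * a.2 + s * b.2)].

(* In [M k l] the first index [k] is the COLUMN (left to right) and the second
   index [l] is the ROW (bottom to top), contrary to the usual reading of
   'M_(t, u). As indices are 0-based, the cell (k, l) is the unit square with
   lower left corner (k, l). *)
Definition standard_figure (R : realType) (t u : nat) (M : 'M[int]_(t, u)) :
    set (R * R) :=
  [set z | exists (k : 'I_t) (l : 'I_u),
     (M k l = 1 /\
        open_segment (k%:R, l%:R) (k.+1%:R, l.+1%:R) z) \/
     (M k l = -1 /\
        open_segment (k%:R, l.+1%:R) (k.+1%:R, l%:R) z)].

(* [q v] is the point labelled [v]: labels increase from bottom to top, and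
   reading the labels from left to right gives [p]. Since [pval p] is a
   bijection, the two strict monotonicity conditions also say that no two of
   the points lie on a common horizontal or vertical line. *)
Definition Geom (R : realType) (t u : nat) (M : 'M[int]_(t, u)) :
    set permutation :=
  [set p | exists q : 'I_(plength p) -> R * R,
     [/\ forall v, standard_figure M (q v),
         forall v w : 'I_(plength p), (v < w)%N -> (q v).2 < (q w).2
       & forall i j : 'I_(plength p), (i < j)%N ->
           (q (pval p i)).1 < (q (pval p j)).1]].

Definition geometrically_griddable (R : realType) (C : set permutation) :
    Prop :=
  exists (t u : nat) (M : 'M[int]_(t, u)),
    (forall k l, M k l \in [:: 0; 1; -1]) /\ C `<=` Geom R M.

(* Main.v *)
Require Import Defs.
From mathcomp Require Import all_boot all_order all_algebra all_fingroup.
From mathcomp Require Import boolp classical_sets functions cardinality reals.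
From mathcomp Require Import lra.

(** Fold every unit cell along its two midlines. A point of the standard
    figure is then determined by a distance [d], with [0 < d <= 1/2], and by
    the two half-unit intervals that contain its coordinates: both coordinates
    lie at distance [d] from the integer endpoints of these intervals
    ([standard_figure_polar]). So once the points of a permutation of a
    geometric grid class are listed by increasing [d], the relative position of
    two of them depends only on which one is listed first and on the finitely
    many values of the pair of half-intervals ([coord_lt]).

    The permutation is thus encoded by a word over a finite alphabet
    ([Geom_encodes]), with one letter for each point, and deleting letters
    amounts to deleting points, so that containment of permutations follows
    from the subword order ([encodes_contained]). By Higman's lemma ([higman])
    every sequence of words contains an earlier word that is a subword of a
    later one, which excludes infinite antichains. There is no infinite strictly
    descending chain of permutations at all, because lengths decrease along
    it. *)

Set Implicit Arguments.
Unset Strict Implicit.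
Unset Printing Implicit Defensive.

Import Order.TTheory GRing.Theory Num.Theory.

(** * Higman's lemma for a finite alphabet *)

Lemma chain_of_successors (r : nat -> nat -> Prop) :
    (forall n, exists2 m, n < m & r n m) ->
  exists2 phi : nat -> nat,
    {homo phi : m n / m < n} & forall k, r (phi k) (phi k.+1).
Proof.
move=> r_next.
have /choice[next nextP] n : exists m, n < m /\ r n m.
  by have [m ? ?] := r_next n; exists m.
exists (fun k => iter k next 0) => [|k]; last by case: (nextP (iter k next 0)).
apply: homo_ltn => [y x z|i]; first exact: ltn_trans.
by case: (nextP (iter i next 0)).
Qed.

(** The well quasi-ordering of [L] by the subword order, in the form that asks
    for an infinite increasing subsequence rather than for one increasing
    pair: the two are equivalent, but this form passes to unions and products
    of languages by successive extraction. *)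
Definition subword_wqo (T : eqType) (L : set (seq T)) : Prop :=
  forall w : nat -> seq T, (forall n, L (w n)) ->
  exists2 phi : nat -> nat, {homo phi : m n / m < n} &
    forall m n, m <= n -> subseq (w (phi m)) (w (phi n)).

Lemma subword_wqoS (T : eqType) (L1 L2 : set (seq T)) :
  (forall w, L1 w -> L2 w) -> subword_wqo L2 -> subword_wqo L1.
Proof. by move=> L12 wqo2 w L1w; apply: wqo2 => n; apply: L12. Qed.

Lemma subword_wqoU (T : eqType) (L1 L2 : set (seq T)) :
  subword_wqo L1 -> subword_wqo L2 -> subword_wqo (fun w => L1 w \/ L2 w).
Proof.
move=> wqo1 wqo2 w Lw.
have [[N L1w]|not_ev1] := pselect (exists N, forall n, N < n -> L1 (w n)).
  have [|phi phi_lt phi_sub] := wqo1 (fun n => w (N.+1 + n)).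
    by move=> n; apply: L1w; rewrite leq_addr.
  by exists (fun n => N.+1 + phi n) => // m n mn; rewrite ltn_add2l phi_lt.
have [|phi phi_lt L2w] := @chain_of_successors (fun _ m => L2 (w m)).
  move=> n; apply: contrapT => none; apply: not_ev1; exists n => m nm.
  by case: (Lw m) => // L2wm; case: none; exists m.
have [//|psi psi_lt psi_sub] := wqo2 (fun n => w (phi n.+1)).
by exists (fun n => phi (psi n).+1) => // m n mn; apply: phi_lt; apply: psi_lt.
Qed.

Lemma subword_wqo_cat (T : eqType) (a : T) (L1 L2 : set (seq T)) :
    subword_wqo L1 -> subword_wqo L2 ->
  subword_wqo (fun w => exists u v, [/\ L1 u, L2 v & w = u ++ a :: v]).
Proof.
move=> wqo1 wqo2 w Lw.
have [u /choice[v uvP]] := choice Lw.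
have [|phi phi_lt phi_sub] := wqo1 u; first by move=> n; case: (uvP n).
have [|psi psi_lt psi_sub] := wqo2 (v \o phi).
  by move=> n /=; case: (uvP (phi n)).
exists (phi \o psi) => [m n mn|m n mn /=]; first by apply: phi_lt; apply: psi_lt.
have [_ _ ->] := uvP (phi (psi m)); have [_ _ ->] := uvP (phi (psi n)).
rewrite cat_subseq //= ?eqxx ?psi_sub //; apply: phi_sub.
by move: mn; rewrite leq_eqVlt => /orP[/eqP-> //|/psi_lt/ltnW].
Qed.

(** A word avoiding [a :: w] either has no letter [a], or splits at its first
    [a] into a word without [a] and a word avoiding [w]. Hence the words that
    avoid a given word are built by unions and products from words over smaller
    alphabets. *)
Lemma subword_wqo_avoid (T : finType) (A : {set T}) (w0 : seq T) :
    (forall a, a \in A ->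
       subword_wqo (fun w => {subset w <= A :\ a})) ->
    {subset w0 <= A} ->
  subword_wqo (fun w => {subset w <= A} /\ ~~ subseq w0 w).
Proof.
move=> wqoA; elim: w0 => [_ w wP|a w0 IHw0 w0A].
  by have [_] := wP 0; rewrite sub0seq.
have aA : a \in A by apply: w0A; rewrite mem_head.
have wqo0 : subword_wqo (fun w => {subset w <= A} /\ ~~ subseq w0 w).
  by apply: IHw0 => b bw0; rewrite w0A // inE bw0 orbT.
have wqoAa := wqoA a aA.
have := subword_wqoU wqoAa (subword_wqo_cat (a := a) wqoAa wqo0).
apply: subword_wqoS => w [wA w0w].
have [aw|aw] := boolP (a \in w); last first.
  by left=> b bw; rewrite !inE wA // andbT; apply: contraNneq aw => <-.
right; move: (aw) wA w0w; rewrite -has_pred1 => /split_find[b u v /eqP ->{b} au].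
rewrite cat_rcons => wA w0w; exists u, v; split=> //.
  move=> b bu; rewrite !inE wA ?mem_cat ?bu // andbT.
  by apply: contraNneq au => <-; rewrite has_pred1.
split=> [b bv|]; first by rewrite wA // mem_cat inE bv !orbT.
apply: contra w0w => w0v; rewrite -[a :: w0]cat0s.
by rewrite cat_subseq ?sub0seq //= eqxx.
Qed.

(** Induction on the alphabet: if some term of the sequence embeds in no later
    term, then all later terms avoid it; otherwise each term embeds in a later
    one, and iterating gives an infinite increasing subsequence. *)
Lemma higman (T : finType) (A : {set T}) :
  subword_wqo (fun w : seq T => {subset w <= A}).
Proof.
have [n] := ubnP #|A|; elim: n A => // n IHn A; rewrite ltnS => cardA w wA.
have [[N avoidN]|no_avoid] :=
  pselect (exists N, forall m, N < m -> ~~ subseq (w N) (w m)).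
  have [|||phi phi_lt phi_sub] :=
      @subword_wqo_avoid _ A (w N) _ _ (fun n => w (N.+1 + n)).
  - by move=> a aA; apply: IHn; apply: leq_trans cardA; rewrite (cardsD1 a A) aA.
  - exact: wA.
  - by move=> m; split; [exact: wA | apply: avoidN; rewrite leq_addr].
  by exists (fun n => N.+1 + phi n) => // m m' mm'; rewrite ltn_add2l phi_lt.
have [|phi phi_lt phi_sub] :=
    @chain_of_successors (fun k m => subseq (w k) (w m)).
  move=> k; apply: contrapT => none; apply: no_avoid; exists k => m km.
  by apply/negP => sub; apply: none; exists m.
exists phi => // m m' mm'.
apply: (@homo_leq _ (w \o phi) (fun u v => subseq u v)) => //.
by move=> y x z; apply: subseq_trans.
Qed.

(** * Words encoding permutations *)

(** The pair [(k, h)] stands for the left half ([h = false]) or the right half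
    ([h = true]) of the interval from [k] to [k + 1]. *)
Definition half_interval (t : nat) : Type := ('I_t * bool)%type.

(** Whether a point of the half-interval [a] lies to the left of a distinct
    point of [b] that is at least as far from its integer endpoint. Within one
    unit interval [a] alone decides: a left half has its integer endpoint at
    the far left of the unit interval, a right half at the far right. *)
Definition before (t : nat) (a b : half_interval t) : bool :=
  (a.1 < b.1) || (a.1 == b.1) && ~~ a.2.

(** The list [s] is the order, by distance from the integer endpoints, in which
    the entries of [p] are read; [c] assigns to the entry at a position the
    half-intervals of its abscissa and ordinate. *)
Definition encodes (t u : nat) (p : permutation)
    (w : seq (half_interval t * half_interval u)) : Prop :=
  exists s (c : 'I_(plength p) -> half_interval t * half_interval u),
    [/\ perm_eq s (enum 'I_(plength p)), w = map c s &
        pairwise (fun i j : 'I_(plength p) =>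
          ((i < j) == before (c i).1 (c j).1) &&
          ((Defs.pval p i < Defs.pval p j) == before (c i).2 (c j).2)) s].

(** A subword of [w'] selects entries of [p'], still listed in their order. The
    letters and this order determine all comparisons of positions and of
    values, so the selected entries are order isomorphic to [p]. *)
Lemma encodes_contained (t u : nat) (p p' : permutation)
    (w w' : seq (half_interval t * half_interval u)) :
  encodes p w -> encodes p' w' -> subseq w w' -> contained p p'.
Proof.
move=> [s [c [s_all -> s_ok]]] [s' [c' [s'_all -> s'_ok]]] /subseqP[m _].
have s'_uniq : uniq s' by rewrite (perm_uniq s'_all) enum_uniq.
rewrite -map_mask; have := pairwise_mask m s'_ok; have := mask_uniq s'_uniq m.
move: (mask m s') => {s'_all s'_ok s'_uniq}s' s'_uniq s'_ok c_eq.
have size_s' : size s' = size s by rewrite -(size_map c') -c_eq size_map.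
have s_uniq : uniq s by rewrite (perm_uniq s_all) enum_uniq.
have s_mem i : i \in s by rewrite (perm_mem s_all) mem_enum.
have idx_lt i : index i s < size s' by rewrite size_s' index_mem.
pose f i := tnth (in_tuple s') (Ordinal (idx_lt i)).
have fE i d : f i = nth d s' (index i s) by rewrite /f (tnth_nth d).
have cf i : c' (f i) = c i.
  rewrite (fE i (f i)) -(nth_map _ (c i)) // -c_eq.
  by rewrite (nth_map i) ?index_mem // nth_index.
(* For positions in the order of the list both comparisons are read off from the
   same two letters; the other order follows by antisymmetry. *)
have fwd (i j : 'I_(plength p)) : index i s < index j s ->
    (i < j) = (f i < f j) /\
    (Defs.pval p i < Defs.pval p j) = (Defs.pval p' (f i) < Defs.pval p' (f j)).
  move=> ij; have /(pairwiseP i)/(_ _ _ _ _ ij) := s_ok.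
  rewrite !inE !index_mem !s_mem !nth_index // => /(_ isT isT)/andP[/eqP-> /eqP->].
  have /(pairwiseP (f i))/(_ _ _ _ _ ij) := s'_ok.
  by rewrite !inE !idx_lt -!fE !cf => /(_ isT isT)/andP[/eqP-> /eqP->].
have lt_anti (n : nat) (a b : 'I_n) : a != b -> (a < b) = ~~ (b < a).
  by move=> ab; rewrite -leqNgt [RHS]leq_eqVlt val_eqE (negbTE ab).
have both (i j : 'I_(plength p)) : (i < j) = (f i < f j) /\
    (Defs.pval p i < Defs.pval p j) = (Defs.pval p' (f i) < Defs.pval p' (f j)).
  have [/fwd //|ji|ij] := ltngtP (index i s) (index j s); last first.
    by have -> := @index_inj _ i s i j (s_mem i) (s_mem j) ij; rewrite !ltnn.
  have [x_eq y_eq] := fwd _ _ ji.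
  have ij : i != j by apply: contraTneq ji => ->; rewrite ltnn.
  have fij : f i != f j.
    rewrite (fE i (f i)) (fE j (f i)) nth_uniq //.
    by apply: contraTneq ji => ->; rewrite ltnn.
  rewrite (lt_anti _ i j) // x_eq -lt_anti //; split=> //.
  by rewrite lt_anti ?(inj_eq perm_inj) // y_eq -lt_anti ?(inj_eq perm_inj).
by exists f; split=> i j; [rewrite -(both i j).1 | exact: (both i j).2].
Qed.

(** * Polar form of the standard figure *)

Section Geometry.

Local Open Scope ring_scope.

Definition coord (R : realType) (t : nat) (a : half_interval t) (d : R) : R :=
  a.1%:R + (if a.2 then 1 - d else d).

(** Both distances being at most 1/2, the point of a left half never exceeds
    the point of the right half of the same unit interval; the two can meet
    only at the midpoint, which the last hypothesis rules out. *)
Lemma coord_lt (R : realType) (t : nat) (a b : half_interval t) (d e : R) :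
    0 < d -> d <= e -> e <= 2^-1 -> coord a d != coord b e ->
  (coord a d < coord b e) = before a b.
Proof.
case: a b => [k h] [l h']; rewrite /coord /before /= => d_gt0 de e_le.
case: (ltngtP k l) => [kl|lk|kl] /=.
- have : k.+1%:R <= l%:R :> R by rewrite ler_nat.
  rewrite -natr1 => kl1 _; apply/idP; case: h h' => -[]; lra.
- have : l.+1%:R <= k%:R :> R by rewrite ler_nat.
  rewrite -natr1 => lk1 _; rewrite -(val_eqE k l) gtn_eqF //=.
  apply/negbTE; rewrite -leNgt; case: h h' => -[]; lra.
rewrite (val_inj kl) eqxx /=; case: h => neq /=.
  by apply/negbTE; rewrite -leNgt; case: h' {neq}; lra.
by rewrite lt_neqAle neq; case: h' {neq} => /=; lra.
Qed.

(** On a diagonal of a unit cell, both coordinates are at the same distance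
    from the nearest integer. *)
Lemma standard_figure_polar (R : realType) (t u : nat) (M : 'M[int]_(t, u))
    (z : R * R) :
    standard_figure M z ->
  exists (c : half_interval t * half_interval u) (d : R),
    [/\ 0 < d, d <= 2^-1 & z = (coord c.1 d, coord c.2 d)].
Proof.
have half (s : R) : 0 < s < 1 -> exists (h : bool) (d : R),
    [/\ 0 < d, d <= 2^-1, s = (if h then 1 - d else d) &
       1 - s = (if ~~ h then 1 - d else d)].
  move=> /andP[s0 s1]; have [s_le|s_gt] := leP s 2^-1.
    by exists false, s.
  by exists true, (1 - s); split=> //; lra.
move=> [k [l [|] [_ [s /half[h [d [d0 d1 sE s'E]]] ->]]]].
  exists ((k, h), (l, h)), d; split=> //; rewrite /coord /= -sE -!natr1.
  by congr pair; lra.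
exists ((k, h), (l, ~~ h)), d; split=> //; rewrite /coord /= -sE -s'E -!natr1.
by congr pair; lra.
Qed.

(** Ties in the distance may be broken arbitrarily, because [coord_lt] only
    needs the weak inequality between the distances once the coordinates are
    known to differ. *)
Lemma Geom_encodes (R : realType) (t u : nat) (M : 'M[int]_(t, u))
    (p : permutation) :
  Geom R M p -> exists w : seq (half_interval t * half_interval u), encodes p w.
Proof.
move=> [q [q_fig q_y q_x]].
have /choice[c /choice[d cdP]] i :=
  standard_figure_polar (q_fig (Defs.pval p i)).
pose leT := relpre d <=%R.
have leT_trans : transitive leT by move=> y x z; apply: le_trans.
have leT_total : total leT by move=> x y; apply: le_total.
exists (map c (sort leT (enum 'I_(plength p)))).
exists (sort leT (enum 'I_(plength p))), c; split=> //.
  by apply/permPl; exact: perm_sort.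
have := sort_sorted leT_total (enum 'I_(plength p)).
have : uniq (sort leT (enum 'I_(plength p))) by rewrite sort_uniq enum_uniq.
rewrite uniq_pairwise sorted_pairwise // => neqs les.
move/andP: (conj neqs les); rewrite -pairwise_relI.
apply: sub_pairwise => i j /= /andP[ij le_d].
have [di0 _ qi] := cdP i; have [_ dj1 qj] := cdP j.
have x_le := le_mono q_x; have y_le := le_mono q_y.
have x_neq := inj_eq (inc_inj x_le) i j.
have y_neq := inj_eq (inc_inj y_le) (Defs.pval p i) (Defs.pval p j).
have := leW_mono y_le (Defs.pval p i) (Defs.pval p j); rewrite ltEord => <-.
have := leW_mono x_le i j; rewrite ltEord => <-.
move: x_neq y_neq; rewrite (inj_eq perm_inj) (negbTE ij) qi qj /=.
by move=> /negbT x_neq /negbT y_neq; rewrite !coord_lt // !eqxx.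
Qed.

End Geometry.

(** * Partial well-ordering *)

Lemma incr_ord_ge (n : nat) (f : 'I_n -> 'I_n) :
  (forall i j : 'I_n, i < j -> f i < f j) -> forall i : 'I_n, i <= f i.
Proof.
move=> f_lt [m]; elim: m => // m IHm lt_m.
by apply: leq_ltn_trans (IHm (ltnW lt_m)) _; apply: f_lt.
Qed.

(** Both [f] and its inverse, which is increasing too, are at least the
    identity. *)
Lemma incr_ord_id (n : nat) (f : 'I_n -> 'I_n) :
  (forall i j : 'I_n, i < j -> f i < f j) -> f =1 id.
Proof.
move=> f_lt i; have f_le := @le_mono _ _ 'I_n 'I_n f f_lt.
have f_inj := inc_inj f_le.
apply/val_inj/eqP; rewrite eqn_leq (incr_ord_ge f_lt) andbT.
rewrite -[X in _ <= \val X](invF_f f_inj); apply: incr_ord_ge => j k.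
have := leW_mono f_le (invF f_inj j) (invF f_inj k).
by rewrite !f_invF !ltEord => ->.
Qed.

(** The embedding is an increasing map between ordinals of the same size, so
    it is the identity; then the map from the values of [s] to those of [p] is
    increasing as well, hence also the identity. *)
Lemma contained_eq (s p : permutation) :
  contained s p -> plength p <= plength s -> s = p.
Proof.
case: s p => [m s] [n p] [f]; rewrite /plength /Defs.pval /= => -[f_lt f_val] nm.
have f_inj := inc_inj (@le_mono _ _ 'I_m 'I_n f f_lt).
have := leq_card f f_inj; rewrite !card_ord => mn.
have mn_eq : m = n by apply/eqP; rewrite eqn_leq mn.
case: n / mn_eq p f f_lt f_val {nm mn f_inj} => p f /incr_ord_id f_id f_val.
have ps_id i : p (s^-1 i)%g = i.
  apply: (@incr_ord_id _ (fun i => p (s^-1 i)%g)) => j k.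
  by have := f_val (s^-1 j)%g (s^-1 k)%g; rewrite !f_id !permKV => <-.
by congr existT; apply/permP => i; rewrite -{1}(ps_id (s i)) permK.
Qed.

Theorem theorem6p1 (R : realType) (C : set permutation)
    (hC : permutation_class C) (hG : geometrically_griddable R C) :
  partially_well_ordered contained C.
Proof.
split=> [[a a_chain]|[A [AC A_inf A_anti]]].
  have a_lt n : plength (a n.+1) < plength (a n).
    rewrite ltnNge; apply/negP => le_n; have [_ [sub neq]] := a_chain n.
    exact: neq (contained_eq sub le_n).
  have a_le n : n + plength (a n) <= plength (a 0).
    elim: n => // n IHn; apply: leq_trans IHn.
    by rewrite addSnnS leq_add2l.
  by have := leq_trans (leq_addr _ _) (a_le (plength (a 0)).+1); rewrite ltnn.
have [t [u [M [_ C_Geom]]]] := hG.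
have /card_leP/unsquash g := (infiniteP A).1 A_inf.
pose a (n : nat) : permutation :=
  \val (g (SigSub (mem_set (I : [set: nat]%classic n)))).
have Aa n : A (a n) by apply: set_mem; exact: valP.
have a_inj m n : a m = a n -> m = n.
  by move=> /val_inj/inj/(congr1 val); apply; rewrite inE.
have /choice[w aw] n := Geom_encodes (C_Geom _ (AC _ (Aa n))).
have [|phi phi_lt phi_sub] := @higman _ [set: _] w.
  by move=> n x; rewrite inE.
apply: (A_anti (a (phi 0)) (a (phi 1))) => //.
  by move/a_inj=> eq; have := phi_lt 0 1 isT; rewrite eq ltnn.
exact: encodes_contained (aw _) (aw _) (phi_sub 0 1 isT).
Qed.
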